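(* Let $X$ and $Y$ be non-empty locally compact Hausdorff spaces and let $T\colon C_0(X,\mathbb{C})\to C_0(Y,\mathbb{C})$ be a ring isomorphism in norm. Assume that $\|T(\overline{f})\|=\|T(f)\|$ for every $f\in C_0(X,\mathbb{C})$. Then there exist a continuous function $w\colon Y\to\mathbb{T}$, a homeomorphism $\varphi\colon Y\to X$, and a closed and open subset $Y_0\subset Y$ such that \[ T(f)(y)= \begin{cases} w(y)f(\varphi(y)),&y\in Y_0,\\ w(y)\overline{f(\varphi(y))},&y\in Y\setminus Y_0, \end{cases} \] for every $f\in C_0(X,\mathbb{C})$ and $y\in Y$. Conversely, for every continuous function $w\colon Y\to\mathbb{T}$, every homeomorphism $\varphi\colon Y\to X$ and every closed and open subset $Y_0\subset Y$, the map $T\colon C_0(X,\mathbb{C})\to C_0(Y,\mathbb{C})$ given by $T(f)(y)=w(y)f(\varphi(y))$ for $y\in Y_0$ and $T(f)(y)=w(y)\overline{f(\varphi(y))}$ for $y\in Y\setminus Y_0$ $(f\in C_0(X,\mathbb{C}))$ is a ring isomorphism in norm and satisfies $\|T(\overline{f})\|=\|T(f)\|$ for every $f\in C_0(X,\mathbb{C})$.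
   Context: $C_0(X,\mathbb{C})$ is the Banach algebra of all continuous $\mathbb{C}$-valued functions on $X$ vanishing at infinity, with the supremum norm $\|\cdot\|$ and pointwise operations; similarly for $Y$. $\overline{f}$ is the pointwise complex conjugate of $f$. $\mathbb{T}=\{\lambda\in\mathbb{C}:|\lambda|=1\}$. A map $T\colon C_0(X,\mathbb{C})\to C_0(Y,\mathbb{C})$ is called a ring isomorphism in norm if it is a bijection (not assumed linear, additive, multiplicative or continuous) and satisfies $\|T(f+g)\|=\|T(f)+T(g)\|$ and $\|T(fg)\|=\|T(f)T(g)\|$ for every $f,g\in C_0(X,\mathbb{C})$. *)

(* Defs.v *)
From HB Require Import structures.
From mathcomp Require Import all_boot all_order all_algebra.
From mathcomp Require Import complex.
From mathcomp Require Import all_classical all_reals all_analysis.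

Set Implicit Arguments.
Unset Strict Implicit.
Unset Printing Implicit Defensive.

Import Order.TTheory GRing.Theory Num.Theory numFieldNormedType.Exports.
Import ComplexField.Normc.

Local Open Scope classical_set_scope.
Local Open Scope ring_scope.
Local Open Scope complex_scope.

(* The topology of R[i] is the one induced by its norm; this makes the generic
   instances on a numFieldType available on the concrete type R[i]. *)
HB.instance Definition _ (R : realType) := NormedModule.copy R[i] R[i]^o.

(* normc is the R-valued modulus; `|z| : R[i] is (normc z)%:C. *)
Section complex_continuity.
Context {R : realType}.
Implicit Types z : R[i].

Lemma normc_dist z1 z2 : `|normc z1 - normc z2| <= normc (z1 - z2).
Proof. exact: (@ler_dist_dist _ (Rcomplex R)). Qed.

Lemma normc_ge0 z : 0 <= normc z.
Proof. by case: z => a b; exact: sqrtr_ge0. Qed.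

Lemma continuous_normc : continuous (@normc R : R[i] -> R).
Proof.
move=> z; apply: (iffRL (@cvgrPdist_lt _ _ _ (nbhs z) _ _ _)) => e e0.
apply/nbhs_normP; exists e%:C => [|t /=]; first by rewrite /= ltcR.
by rewrite ltcR; exact/le_lt_trans/normc_dist.
Qed.

Lemma normc_conj z : normc (conjc z) = normc z.
Proof. by case: z => a b /=; rewrite sqrrN. Qed.

Lemma continuous_conjc : continuous (@conjc R : R[i] -> R[i]).
Proof.
move=> z; apply: (iffRL (@cvgrPdist_lt _ _ _ (nbhs z) _ _ _)) => e e0.
apply/nbhs_normP; exists e => // t /=.
by rewrite -rmorphB /Num.norm /= normc_conj.
Qed.

End complex_continuity.

Section C0.
Context {R : realType} {X : topologicalType}.

Definition vanishes_at_infinity (f : X -> R[i]) :=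
  forall e : R, 0 < e -> compact [set x | e <= normc (f x)].

Definition is_C0 : {pred X -> R[i]} :=
  mem [set f : X -> R[i] | continuous f /\ vanishes_at_infinity f].

Lemma is_C0P (f : X -> R[i]) :
  f \in is_C0 <-> continuous f /\ vanishes_at_infinity f.
Proof. by split=> [/set_mem|/mem_set]. Qed.

Lemma closed_level (f : X -> R[i]) (e : R) :
  continuous f -> closed [set x | e <= normc (f x)].
Proof.
move=> cf; rewrite -[X in closed X]/((@normc R \o f) @^-1` [set r | e <= r]).
apply: preimage_closed; last exact: closed_ge.
by move=> x _; apply: continuous_comp; [exact: cf|exact: continuous_normc].
Qed.

Lemma vanishesS (f g h : X -> R[i]) : continuous h ->
  vanishes_at_infinity f -> vanishes_at_infinity g ->
  (forall e, 0 < e -> exists2 d, 0 < d & forall x,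
     e <= normc (h x) -> d <= normc (f x) \/ d <= normc (g x)) ->
  vanishes_at_infinity h.
Proof.
move=> ch f0 g0 H e /H[d d0 hd].
apply: (@subclosed_compact _ _
  ([set x | d <= normc (f x)] `|` [set x | d <= normc (g x)])).
- exact: closed_level.
- by apply: compactU; [exact: f0|exact: g0].
- by move=> x /hd.
Qed.

Lemma C0_zmod_closed : zmod_closed is_C0.
Proof.
split.
  apply/is_C0P; split; first by move=> x; exact: cvg_cst.
  move=> e e0; rewrite (_ : [set x | _] = set0); first exact: compact0.
  apply/seteqP; split => // x /=.
  by rewrite [X in _ <= X](_ : _ = 0) ?leNgt ?e0//; exact: normc0.
move=> f g /is_C0P[cf f0] /is_C0P[cg g0]; apply/is_C0P.
have cfg : continuous (f - g).
  by move=> x; apply: cvgB; [exact: cf|exact: cg].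
split => //; apply: (vanishesS cfg f0 g0) => e e0.
exists (e / 2) => [|x efg]; first by rewrite divr_gt0.
have [|fx] := leP (e / 2) (normc (f x)); first by left.
right; rewrite leNgt; apply/negP => gx.
have : normc ((f - g) x) < e.
  rewrite [e in _ < e]splitr (le_lt_trans _ (ltrD fx gx))//.
  by rewrite -[normc (g x)]normcN; exact: le_normcD.
by rewrite ltNge efg.
Qed.

HB.instance Definition _ :=
  GRing.isZmodClosed.Build (X -> R[i]) is_C0 C0_zmod_closed.

Record C0 := MkC0 { C0_fun :> X -> R[i] ; C0_funP : C0_fun \in is_C0 }.

HB.instance Definition _ := [isSub for C0_fun].
HB.instance Definition _ := [Choice of C0 by <:].
HB.instance Definition _ := [SubChoice_isSubZmodule of C0 by <:].

Lemma C0_continuous (f : C0) : continuous f.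
Proof. by have /is_C0P[] := C0_funP f. Qed.

Lemma C0_vanishes (f : C0) : vanishes_at_infinity f.
Proof. by have /is_C0P[] := C0_funP f. Qed.

Lemma C0_mul_subproof (f g : C0) : (fun x => f x * g x) \in is_C0.
Proof.
apply/is_C0P.
have cfg : continuous (fun x => f x * g x).
  by move=> x; apply: cvgM; exact: C0_continuous.
split => //; apply: (vanishesS cfg (@C0_vanishes f) (@C0_vanishes g)) => e e0.
exists (Num.sqrt e) => [|x]; first by rewrite sqrtr_gt0.
rewrite normcM => efg.
have [|fx] := leP (Num.sqrt e) (normc (f x)); first by left.
right; rewrite leNgt; apply/negP => gx; move: efg; rewrite leNgt => /negP; apply.
by rewrite -[e]sqr_sqrtr ?ltW// expr2 ltr_pM ?normc_ge0.
Qed.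

Definition C0_mul (f g : C0) : C0 := MkC0 (C0_mul_subproof f g).

Lemma C0_conj_subproof (f : C0) : (fun x => conjc (f x)) \in is_C0.
Proof.
apply/is_C0P; split=> [x|e e0].
  apply: (@continuous_comp _ _ _ f (@conjc R)); first exact: C0_continuous.
  exact: continuous_conjc.
rewrite (_ : [set x | _] = [set x | e <= normc (f x)]); first exact: C0_vanishes.
by apply/seteqP; split => x /=; rewrite normc_conj.
Qed.

Definition C0_conj (f : C0) : C0 := MkC0 (C0_conj_subproof f).

Definition C0_norm (f : C0) : R := sup (range (fun x => normc (f x))).

Lemma C0_has_ubound (f : C0) : has_ubound (range (fun x => normc (f x))).
Proof.
have : compact (@normc R @` (f @` [set x | 1 <= normc (f x)])).
  apply: continuous_compact.
    by apply: continuous_subspaceT; exact: continuous_normc.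
  apply: continuous_compact; last exact: C0_vanishes.
  by apply: continuous_subspaceT; exact: C0_continuous.
move=> /compact_bounded[M [_ /(_ (M + 1))]].
rewrite ltrDl ltr01 => /(_ isT) Mf; exists (Num.max 1 (M + 1)) => _ [x _ <-].
rewrite le_max; have [//|fx] := leP (normc (f x)) 1.
apply: le_trans (Mf (normc (f x)) _); first exact: ler_norm.
by exists (f x) => //; exists x => //=; exact: ltW.
Qed.

Lemma C0_le_norm (f : C0) x : normc (f x) <= C0_norm f.
Proof. by apply: ub_le_sup; [exact: C0_has_ubound|exists x]. Qed.

Lemma C0_norm_le (f : C0) (M : R) : 0 <= M ->
  (forall x, normc (f x) <= M) -> C0_norm f <= M.
Proof.
move=> M0 fM; have [ne|] := pselect (range (fun x => normc (f x)) !=set0).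
  by apply: ge_sup => // _ [x _ <-].
by move=> /nonemptyPn; rewrite /C0_norm => ->; rewrite sup0.
Qed.

Lemma C0_norm_ge0 (f : C0) : 0 <= C0_norm f.
Proof.
have [[_ [x _ _]]|] := pselect (range (fun x => normc (f x)) !=set0).
  by apply: le_trans (C0_le_norm f x); exact: normc_ge0.
by move=> /nonemptyPn; rewrite /C0_norm => ->; rewrite sup0.
Qed.

Lemma C0_normD (f g : C0) : C0_norm (f + g) <= C0_norm f + C0_norm g.
Proof.
apply: C0_norm_le => [|x]; first by rewrite addr_ge0 ?C0_norm_ge0.
by apply: le_trans (le_normcD _ _) _; apply: lerD; exact: C0_le_norm.
Qed.

Lemma C0_norm0_eq0 (f : C0) : C0_norm f = 0 -> f = 0.
Proof.
move=> f0; suff: C0_fun f = C0_fun 0 by exact: val_inj.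
apply/funext => x; apply: (@eq0_normc R (f x)).
by apply/eqP; rewrite eq_le normc_ge0 andbT -f0; exact: C0_le_norm.
Qed.

Lemma C0_normN (f : C0) : C0_norm (- f) = C0_norm f.
Proof.
have fN : (fun x => normc ((- f) x)) = (fun x => normc (f x)).
  by apply/funext => x; exact: normcN.
by rewrite /C0_norm fN.
Qed.

Lemma C0_mulrnE (f : C0) n x : (f *+ n) x = f x *+ n.
Proof. by elim: n => // n IH; rewrite !mulrS -IH. Qed.

Lemma C0_normMn (f : C0) n : C0_norm (f *+ n) = C0_norm f *+ n.
Proof.
have fn x : normc ((f *+ n) x) = normc (f x) *+ n.
  by rewrite C0_mulrnE normcMn.
apply/eqP; rewrite eq_le; apply/andP; split.
  apply: C0_norm_le => [|x]; first by rewrite mulrn_wge0 ?C0_norm_ge0.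
  by rewrite fn lerMn2r C0_le_norm orbT.
case: n fn => [|n] fn; first by rewrite mulr0n C0_norm_ge0.
rewrite -mulr_natl -ler_pdivlMl ?ltr0n//; apply: C0_norm_le => [|x].
  by rewrite mulr_ge0 ?invr_ge0 ?C0_norm_ge0.
by rewrite ler_pdivlMl ?ltr0n// mulr_natl -fn C0_le_norm.
Qed.

HB.instance Definition _ := Num.Zmodule_isNormed.Build R C0
  C0_normD C0_norm0_eq0 C0_normMn C0_normN.

Lemma C0_normE (f : C0) : `|f| = sup (range (fun x => normc (f x))).
Proof. by []. Qed.

Lemma C0_addE (f g : C0) x : (f + g) x = f x + g x.
Proof. by []. Qed.

End C0.
Arguments C0 : clear implicits.

Definition homeomorphism (X Y : topologicalType) (phi : X -> Y) :=
  continuous phi /\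
  exists psi : Y -> X, [/\ cancel phi psi, cancel psi phi & continuous psi].

Definition unit_circle (R : realType) : set R[i] := [set z | `|z| = 1].
Arguments unit_circle : clear implicits.

Section maps.
Context {R : realType} {X Y : topologicalType}.
Implicit Type T : C0 R X -> C0 R Y.

Definition ring_isomorphism_in_norm T := [/\ bijective T,
  forall f g, `|T (f + g)| = `|T f + T g| &
  forall f g, `|T (C0_mul f g)| = `|C0_mul (T f) (T g)| ].

End maps.

(* Main.v *)
Require Import Defs.
From mathcomp Require Import all_boot all_order all_algebra.
From mathcomp Require Import complex lra ring.
From mathcomp Require Import all_classical all_reals all_analysis.

Import Order.TTheory GRing.Theory Num.Theory numFieldNormedType.Exports.
Import ComplexField.Normc.

Local Open Scope classical_set_scope.
Local Open Scope ring_scope.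
Local Open Scope complex_scope.

(** T is additive because it is onto: each reflection
    v |-> T (f + g - T^-1 v) is an isometry of C_0(Y) that swaps T f and T g; by
    the Mazur-Ulam argument it fixes their midpoint, which forces
    T (f + g) = T f + T g ([norm_additive_additive]).

    The norm identities are in fact pointwise.  The identity
    |T (f g)| = |T f T g| shows that T preserves and reflects zero products, so
    when T k is concentrated near y, so are T (g k) and T (conj k).  On such a
    small support |T g| is almost the constant |T g (y)|, and comparing norms
    gives |T (f g)(y)| = |T f (y)| |T g (y)| and |T (conj f)(y)| = |T f (y)|
    ([image_normcM], [image_normc_conj]).

    It remains to study one functional tau(f) = T f (y): additive, with
    multiplicative modulus, and blind to conjugation in modulus.  Polarizing
    these modulus identities gives identities for the real inner product of the
    plane.  They put the values of tau on real functions on one real line, and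
    those on imaginary functions on the orthogonal line.  Along the first line
    tau is, up to a unit factor, a nonzero ring homomorphism
    C_0(X, R) -> R; such a homomorphism preserves positivity because nonnegative
    functions are squares, hence it is real-linear, and by compactness it is the
    evaluation at a point x.  Along the other line tau is the same evaluation up
    to one global sign, which decides between f(x) and its conjugate
    ([functional_eval]).

    Letting y vary gives w, phi and Y0; bump functions make w and phi continuous
    and Y0 clopen.  They also show that T preserves the norm, so that T^-1
    satisfies the same hypotheses and produces a continuous inverse of phi.
    The converse is a direct verification, the inverse of the constructed map
    being of the same form. *)

(** * Additivity of maps additive in norm *)

(** If S moves the midpoint z by d, then composing S^-1 and S with the point
    reflection through z gives another isometry fixing a and b that moves z by
    2 d. Iterating, 2^n d stays below the fixed bound 2 |z - a|, so d = 0 (the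
    Mazur-Ulam theorem, in Vaisala's form). *)
Lemma isometry_fixes_midpoint {R : realType} {V : normedZmodType R}
    {S S' : V -> V} {a b z : V} :
  cancel S S' -> cancel S' S -> (forall u v, `|S u - S v| = `|u - v|) ->
  S a = a -> S b = b -> z *+ 2 = a + b -> S z = z.
Proof.
move=> SK SK' iso Sa Sb zab.
pose refl (v : V) := a + b - v.
have reflK : involutive refl by move=> v; rewrite /refl opprB addrC subrK.
have refl_iso u v : `|refl u - refl v| = `|u - v|.
  by rewrite /refl opprB addrC addrA subrK distrC.
have refla : refl a = b by rewrite /refl addrC addKr.
have reflb : refl b = a by rewrite /refl addrK.
have doubling n : forall S S' : V -> V, cancel S S' -> cancel S' S ->
    (forall u v, `|S u - S v| = `|u - v|) -> S a = a -> S b = b ->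
    `|S z - z| *+ 2 ^ n <= `|z - a| *+ 2.
  elim: n => [|n IH] {SK SK' iso Sa Sb S'} {}S S' SK SK' iso Sa Sb.
    rewrite expn0 mulr1n mulr2n -[in X in _ <= X + _](iso z a) Sa.
    by rewrite [X in _ <= _ + X]distrC -[S z - z](subrKA a) ler_normD.
  have iso' u v : `|S' u - S' v| = `|u - v| by rewrite -iso !SK'.
  have S'a : S' a = a by rewrite -{1}Sa SK.
  have S'b : S' b = b by rewrite -{1}Sb SK.
  (* this composite moves z twice as far as S does *)
  have := IH (refl \o S' \o refl \o S) (S' \o refl \o S \o refl).
  have -> : `|(refl \o S' \o refl \o S) z - z| = `|S z - z| *+ 2.
    have reflz : refl z = z by rewrite /refl -zab mulr2n addrK.
    rewrite /= -{2}reflz refl_iso -{2}(SK z) iso' /refl -zab.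
    by rewrite -addrA -opprD -mulr2n -mulrnBl normrMn distrC.
  rewrite -mulrnA -expnS; apply.
  - by move=> v /=; rewrite reflK SK' reflK SK.
  - by move=> v /=; rewrite SK' reflK SK reflK.
  - by move=> u v /=; rewrite refl_iso iso' refl_iso iso.
  - by rewrite /= Sa refla S'b reflb.
  - by rewrite /= Sb reflb S'a refla.
apply/eqP; rewrite -subr_eq0 -normr_le0 leNgt; apply/negP => d0.
set d := `|S z - z| in d0; set c := `|z - a| *+ 2.
have := archi_boundP (divr_ge0 (mulrn_wge0 2 (normr_ge0 (z - a))) (ltW d0)).
rewrite -/c ltr_pdivrMr// mulr_natl; apply/negP; rewrite -leNgt.
apply: le_trans (doubling (Num.bound (c / d)) S S' SK SK' iso Sa Sb).
by rewrite -/d; apply: ler_wpMn2l; [exact: ltW|rewrite ltnW// ltn_expl].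
Qed.

(** The map v |-> T (f + g - T' v) is an isometric involution swapping T f and
    T g. Following it by the reflection through the midpoint z of T f and T g
    gives an isometry fixing both, hence z; so T' z is fixed by h |-> f + g - h
    and is therefore half of f + g. *)
Lemma norm_additive_additive {R : realType} {U : zmodType}
    {V : normedZmodType R} {T : U -> V} :
  (forall f : U, exists h, h *+ 2 = f) ->
  (forall u : V, exists z, z *+ 2 = u) ->
  (forall f g : U, f *+ 2 = g *+ 2 -> f = g) ->
  bijective T -> (forall f g, `|T (f + g)| = `|T f + T g|) ->
  forall f g, T (f + g) = T f + T g.
Proof.
move=> halfU halfV injU [T' TK T'K] normT.
have T0 : T 0 = 0.
  have := normT 0 0; rewrite addr0 -mulr2n normrMn => /eqP.
  rewrite mulr2n -subr_eq0 opprD addrA subrr sub0r oppr_eq0 normr_eq0.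
  by move/eqP.
have TN f : T (- f) = - T f.
  apply/eqP; rewrite -subr_eq0 opprK addrC -normr_eq0 -normT subrr T0.
  by rewrite normr0.
have isoT f g : `|T f - T g| = `|T (f - g)| by rewrite normT TN.
have halfT f g h : h *+ 2 = f + g -> T h *+ 2 = T f + T g.
  move=> hfg; have [z zfg] := halfV (T f + T g).
  pose refl (v : V) := T f + T g - v.
  pose swap (v : V) := T (f + g - T' v).
  have reflK : involutive refl by move=> v; rewrite /refl opprB addrC subrK.
  have swapK : involutive swap.
    by move=> v; rewrite /swap TK opprB addrC subrK T'K.
  suff fixz : refl (swap z) = z.
    have swapz : swap z = z.
      by apply: (can_inj reflK); rewrite fixz /refl -zfg mulr2n addrK.
    rewrite -zfg -swapz; congr (T _ *+ 2); apply: injU.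
    rewrite hfg mulr2n -[in X in _ = _ + X](TK (f + g - T' z)).
    by rewrite -/(swap z) swapz subrK.
  apply: (isometry_fixes_midpoint (S := refl \o swap) (S' := swap \o refl)
    _ _ _ _ _ zfg).
  - by move=> v /=; rewrite reflK swapK.
  - by move=> v /=; rewrite swapK reflK.
  - move=> u v /=; rewrite /refl opprB addrC addrA subrK distrC /swap isoT.
    by rewrite opprB addrC addrA subrK distrC -isoT !T'K.
  - by rewrite /= /swap TK addrAC subrr add0r /refl addrK.
  - by rewrite /= /swap TK addrK /refl addrAC subrr add0r.
move=> f g; have [h hfg] := halfU (f + g).
by rewrite -(halfT f g h hfg) (halfT (f + g) 0 h) ?T0 ?addr0.
Qed.

(** * Functions vanishing at infinity *)

(** The norm of R[i] is complex-valued and its balls have complex radii; here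
    both the modulus and the radius are real. *)
Lemma cvg_normcP {R : realType} {X : topologicalType} {F : set_system X}
    {FF : Filter F} (f : X -> R[i]) (l : R[i]) :
  (forall e : R, 0 < e -> \forall x \near F, normc (l - f x) < e) <->
  f @ F --> l.
Proof.
split=> [H|H e e0].
  apply: (iffRL (@cvgrPdist_lt _ _ _ F _ f l)) => e e0.
  have eR : e = (complex.Re e)%:C by rewrite RRe_real// gtr0_real.
  have Re0 : 0 < complex.Re e by rewrite -ltcR -eR.
  by apply: filterS (H _ Re0) => x; rewrite -ltcR -eR.
have /(iffLR (@cvgrPdist_lt _ _ _ F _ f l)) /(_ e%:C) := H.
rewrite ltcR => /(_ e0).
by apply: filterS => x; rewrite -ltcR.
Qed.

Lemma normc_ge_normRe {R : realType} (z : R[i]) : `|complex.Re z| <= normc z.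
Proof. by rewrite -lecR; exact: normc_ge_Re. Qed.

Lemma normc_real {R : realType} (r : R) : normc (r%:C) = `|r|.
Proof. by rewrite /= expr0n /= addr0 sqrtr_sqr. Qed.

Lemma continuous_Re {R : realType} : continuous (@complex.Re R : R[i] -> R).
Proof.
move=> z; apply: (iffRL (@cvgrPdist_lt _ _ _ (nbhs z) _ _ _)) => e e0.
have : \forall t \near z, normc (z - id t) < e.
  by apply: (iffRL (@cvg_normcP R _ (nbhs z) _ id z) _ e e0); exact: cvg_id.
apply: filterS => t /=; apply: le_lt_trans.
by rewrite -raddfB; exact: normc_ge_normRe.
Qed.

Lemma continuous_real_complex {R : realType} :
  continuous (real_complex R : R -> R[i]).
Proof.
move=> r; apply: (iffLR (cvg_normcP _ _)) => e e0.
have /(iffLR (@cvgrPdist_lt _ _ _ (nbhs r) _ _ _)) /(_ e e0) :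
    (fun x : R => x) @ r --> r.
  exact: cvg_id.
by apply: filterS => x; rewrite -rmorphB normc_real.
Qed.

Section toolkit.
Context {R : realType} {X : topologicalType}.
Implicit Types f g h : C0 R X.

Lemma C0_ext f g : (forall x, f x = g x) -> f = g.
Proof. by move=> fg; apply: val_inj; exact/funext. Qed.

Lemma is_C0_dominated (M : R) f (h : X -> R[i]) : continuous h -> 0 < M ->
  (forall x, normc (h x) <= M * normc (f x)) -> h \in is_C0.
Proof.
move=> ch M0 hf; apply/is_C0P; split=> //.
apply: (vanishesS ch (@C0_vanishes _ _ f) (@C0_vanishes _ _ f)) => e e0.
exists (e / M) => [|x ehx]; first by rewrite divr_gt0.
by left; rewrite ler_pdivrMr// mulrC (le_trans ehx).
Qed.

Lemma C0_scale_subproof (c : R[i]) f : (fun x => c * f x) \in is_C0.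
Proof.
apply: (@is_C0_dominated (normc c + 1) f) => [x||x].
- by apply: cvgM; [exact: cvg_cst|exact: C0_continuous].
- by rewrite ltr_wpDl// Defs.normc_ge0.
- by rewrite normcM ler_wpM2r ?lerDl// Defs.normc_ge0.
Qed.

Definition C0_scale c f : C0 R X := MkC0 (C0_scale_subproof c f).

Definition C0_real f := C0_conj f = f.

Lemma C0_realE {f} : C0_real f -> forall x, f x = (complex.Re (f x))%:C.
Proof.
move=> fR x; have : conjc (f x) = f x by rewrite -[in RHS]fR.
case: (f x) => a b [] /eqP; rewrite eq_sym -subr_eq0 opprK -mulr2n.
by rewrite mulrn_eq0/= => /eqP ->.
Qed.

Lemma C0_realP f : (forall x, complex.Im (f x) = 0) -> C0_real f.
Proof.
move=> f0; apply: C0_ext => x /=; move: (f0 x).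
by case: (f x) => a b /= ->; rewrite oppr0.
Qed.

Lemma C0_conjM f g : C0_conj (C0_mul f g) = C0_mul (C0_conj f) (C0_conj g).
Proof. by apply: C0_ext => x /=; rewrite rmorphM. Qed.

Lemma C0_conjD f g : C0_conj (f + g) = C0_conj f + C0_conj g.
Proof. by apply: C0_ext => x; exact: (rmorphD (@conjc R) (f x) (g x)). Qed.

Lemma C0_conjK f : C0_conj (C0_conj f) = f.
Proof. by apply: C0_ext => x /=; rewrite conjcK. Qed.

Lemma C0_realM f g : C0_real f -> C0_real g -> C0_real (C0_mul f g).
Proof. by move=> fR gR; rewrite /C0_real C0_conjM fR gR. Qed.

Lemma C0_realD f g : C0_real f -> C0_real g -> C0_real (f + g).
Proof. by move=> fR gR; rewrite /C0_real C0_conjD fR gR. Qed.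

Lemma C0_realZ (r : R) f : C0_real f -> C0_real (C0_scale r%:C f).
Proof.
move=> fR; apply: C0_realP => x /=.
by rewrite (C0_realE fR) /= mulr0 mul0r addr0.
Qed.

Lemma C0_Re_mul f g x : C0_real f -> C0_real g ->
  complex.Re (C0_mul f g x) = complex.Re (f x) * complex.Re (g x).
Proof.
by move=> fR gR; rewrite /= (C0_realE fR) (C0_realE gR) /= mulr0 subr0.
Qed.

Lemma C0_Re_scale (r : R) f x :
  complex.Re (C0_scale r%:C f x) = r * complex.Re (f x).
Proof. by case E: (f x) => [a b]; rewrite /= E /= mul0r subr0. Qed.

Lemma C0_Re_add f g x :
  complex.Re ((f + g) x) = complex.Re (f x) + complex.Re (g x).
Proof. by rewrite C0_addE raddfD. Qed.

Lemma normc_C0_real f x : C0_real f -> normc (f x) = `|complex.Re (f x)|.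
Proof. by move=> fR; rewrite (C0_realE fR) normc_real. Qed.

Lemma continuous_C0_Re f : continuous (fun x => complex.Re (f x)).
Proof.
move=> x; apply: (@continuous_comp _ _ _ f (@complex.Re R)).
  exact: C0_continuous.
exact: continuous_Re.
Qed.

Lemma C0_Re_subproof f : (fun x => (complex.Re (f x))%:C) \in is_C0.
Proof.
apply: (@is_C0_dominated 1 f) => [x||x].
- apply: (@continuous_comp _ _ _ (fun x => complex.Re (f x)) (real_complex R)).
    exact: continuous_C0_Re.
  exact: continuous_real_complex.
- exact: ltr01.
- by rewrite mul1r normc_real normc_ge_normRe.
Qed.

(** Reduces an additive functional to its restrictions to real functions and to
    i times real functions. *)
Lemma C0_cartesian f :
  exists a b, [/\ C0_real a, C0_real b & f = a + C0_scale 'i b].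
Proof.
exists (MkC0 (C0_Re_subproof f)), (MkC0 (C0_Re_subproof (C0_scale (- 'i) f))).
split; try by apply: C0_realP.
apply: C0_ext => x; rewrite C0_addE /=.
by case: (f x) => a b /=; simpc.
Qed.

Lemma C0_sqrt f : C0_real f -> (forall x, 0 <= complex.Re (f x)) ->
  exists2 h, C0_real h & C0_mul h h = f.
Proof.
move=> fR f0; pose s x := (Num.sqrt (complex.Re (f x)))%:C.
have cs : continuous s.
  move=> x; apply: (@continuous_comp _ _ _
    (fun x => Num.sqrt (complex.Re (f x))) (real_complex R));
    last exact: continuous_real_complex.
  apply: (@continuous_comp _ _ _ (fun x => complex.Re (f x)) Num.sqrt).
    exact: continuous_C0_Re.
  exact: sqrt_continuous.
have ss x : s x * s x = f x.
  by rewrite [RHS](C0_realE fR) /s -rmorphM -expr2 sqr_sqrtr.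
have sC0 : s \in is_C0.
  apply/is_C0P; split=> //.
  apply: (vanishesS cs (@C0_vanishes _ _ f) (@C0_vanishes _ _ f)) => e e0.
  exists (e ^+ 2) => [|x ehx]; first by rewrite exprn_gt0.
  by left; rewrite -ss normcM -expr2 lerXn2r// nnegrE ?Defs.normc_ge0// ltW.
by exists (MkC0 sC0); [exact: C0_realP|exact: C0_ext].
Qed.

(** Complete regularity gives a separating function; cutting with a compact
    neighbourhood of x makes it vanish at infinity. *)
Lemma C0_bump (x : X) (U : set X) : locally_compact [set: X] ->
  hausdorff_space X -> nbhs x U ->
  exists u : C0 R X, [/\ C0_real u, u x = 1 & forall z, ~ U z -> u z = 0].
Proof.
move=> lc hX Ux.
have [K Kx [cK clK]] : exists2 K, nbhs x K & compact K /\ closed K.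
  have [//|K] := lc x; rewrite withinET => Kx [? ?]; by exists K.
pose V := interior (U `&` K).
have Vx : V x by apply: filterI.
have sep : uniform_separator [set x] (~` V).
  apply: (@locally_compact_completely_regular X R) => //.
    by apply: open_closedC; exact: open_interior.
pose v z := (1 - @Urysohn X R [set x] (~` V) z)%:C.
have v0 z : ~ V z -> v z = 0.
  move=> nVz; have /= uz1 : [set (1 : R)] (Urysohn [set x] (~` V) z).
    by apply: (Urysohn_sub1 sep); exists z.
  by rewrite /v uz1 subrr.
have cv : continuous v.
  move=> z; apply: (@continuous_comp _ _ _
    (fun z => 1 - @Urysohn X R [set x] (~` V) z) (real_complex R)).
    by apply: cvgB; [exact: cvg_cst|exact: Urysohn_continuous].
  exact: continuous_real_complex.
have vC0 : v \in is_C0.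
  apply/is_C0P; split=> // e e0; apply: (subclosed_compact _ cK).
    exact: closed_level.
  move=> z; have [/interior_subset[]//|nVz] := pselect (V z).
  by rewrite /mkset (v0 _ nVz) normc0 leNgt e0.
exists (MkC0 vC0); split=> [||z nUz] /=.
- exact: C0_realP.
- have /= ux0 : [set (0 : R)] (Urysohn [set x] (~` V) x).
    by apply: (Urysohn_sub0 sep); exists x.
  by rewrite /v ux0 subr0.
- by apply: v0 => /interior_subset[].
Qed.

End toolkit.

(** * Ring homomorphisms from the real functions to the reals *)

(** Monotonicity squeezes m r between rational multiples of m 1: with k the
    integer part of n r, both n (m r) and n r (m 1) lie between k (m 1) and (k
    + 1) (m 1), for every n. *)
Lemma nonneg_additive_linear {R : realType} {m : R -> R} :
  (forall a b, m (a + b) = m a + m b) -> (forall a, 0 <= a -> 0 <= m a) ->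
  forall r, m r = r * m 1.
Proof.
move=> mD m_ge0.
have m0 : m 0 = 0 by apply: (addrI (m 0)); rewrite -mD !addr0.
have mN a : m (- a) = - m a.
  by apply/eqP; rewrite -subr_eq0 opprK -mD addNr m0.
have mMn a n : m (a *+ n) = m a *+ n.
  by elim: n => [|n IH]; rewrite ?mulr0n// !mulrS mD IH.
have m_mono a b : a <= b -> m a <= m b.
  by rewrite -subr_ge0 => /m_ge0; rewrite mD mN subr_ge0.
have m_pos r : 0 <= r -> m r = r * m 1.
  move=> r0; apply/eqP; rewrite -subr_eq0 -normr_le0 leNgt; apply/negP => d0.
  have := archi_boundP (divr_ge0 (m_ge0 1 ler01) (ltW d0)).
  set n := Num.bound _; rewrite ltr_pdivrMr//; apply/negP; rewrite -leNgt.
  have rn0 : 0 <= r *+ n by rewrite mulrn_wge0.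
  have /andP[k1 k2] := truncn_itv rn0; set k := Num.truncn _ in k1 k2.
  have mnat j : m j%:R = j%:R * m 1 by rewrite mMn mulr_natl.
  have mrn : m (r *+ n) = n%:R * m r by rewrite mMn mulr_natl.
  have := m_mono _ _ (ltW k2); have := m_mono _ _ k1; rewrite !mnat mrn.
  have := ler_wpM2r (m_ge0 1 ler01) (ltW k2).
  have := ler_wpM2r (m_ge0 1 ler01) k1.
  rewrite -[X in X * `|_|]normr_nat -normrM ler_norml -[r *+ n]mulr_natl -natr1.
  by move=> ? ? ? ?; apply/andP; split; lra.
move=> r; have [/m_pos//|/ltW r0] := leP 0 r.
by rewrite -[r]opprK mN m_pos ?oppr_ge0// !mulNr.
Qed.

Section real_character.
Context {R : realType} {X : topologicalType}.
Implicit Types f g h : C0 R X.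

(** Real functions are kept inside C_0(X, C), so theta is constrained on them
    only. *)
Definition real_character (theta : C0 R X -> R) :=
  [/\ forall f g, C0_real f -> C0_real g -> theta (f + g) = theta f + theta g,
      forall f g, C0_real f -> C0_real g ->
        theta (C0_mul f g) = theta f * theta g &
      exists2 g, C0_real g & theta g != 0].

Variable theta : C0 R X -> R.
Hypothesis character : real_character theta.

Let thetaD f g : C0_real f -> C0_real g -> theta (f + g) = theta f + theta g.
Proof. by case: character => + _ _; exact. Qed.

Let thetaM f g : C0_real f -> C0_real g ->
  theta (C0_mul f g) = theta f * theta g.
Proof. by case: character => _ + _; exact. Qed.

Let theta_ge0 f :
  C0_real f -> (forall x, 0 <= complex.Re (f x)) -> 0 <= theta f.
Proof.
move=> fR f0; have [h hR <-] := C0_sqrt f fR f0.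
by rewrite thetaM// -expr2 sqr_ge0.
Qed.

Let thetaZ_sqr (r : R) g : C0_real g ->
  theta (C0_scale r%:C (C0_mul g g)) = r * theta (C0_mul g g).
Proof.
move=> gR; have ggR := C0_realM _ _ gR gR.
rewrite -[in RHS](_ : C0_scale 1%:C (C0_mul g g) = C0_mul g g); last first.
  by apply: C0_ext => x /=; rewrite mul1r.
apply: (nonneg_additive_linear
  (m := fun r => theta (C0_scale r%:C (C0_mul g g)))) => [a b|a a0].
  rewrite -thetaD; try exact: C0_realZ.
  by congr theta; apply: C0_ext => x; rewrite C0_addE /= rmorphD mulrDl.
apply: theta_ge0 => [|x]; first exact: C0_realZ.
by rewrite C0_Re_scale C0_Re_mul// -expr2 mulr_ge0 ?sqr_ge0.
Qed.

Let thetaZ (r : R) f : C0_real f -> theta (C0_scale r%:C f) = r * theta f.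
Proof.
move=> fR; have [_ _ [g gR g0]] := character.
have g20 : theta (C0_mul g g) != 0 by rewrite thetaM// mulf_neq0.
have ggR := C0_realM _ _ gR gR.
(* f may change sign, so r is moved onto the square C0_mul g g *)
apply: (mulIf g20); rewrite -thetaM//; last exact: C0_realZ.
rewrite mulrAC -thetaZ_sqr// mulrC -thetaM//; last exact: C0_realZ.
by congr theta; apply: C0_ext => x /=; ring.
Qed.

Let theta_le f g : C0_real f -> C0_real g ->
  (forall x, complex.Re (f x) <= complex.Re (g x)) -> theta f <= theta g.
Proof.
move=> fR gR fg; have N1f := C0_realZ (-1) _ fR.
rewrite -subr_ge0 -mulN1r -thetaZ// -thetaD// theta_ge0//.
  exact: C0_realD.
by move=> x; rewrite C0_Re_add C0_Re_scale mulN1r subr_ge0.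
Qed.

(** Normalize theta g = 1 and let K be the compact set where |g| >= 1/2. If
    some nonnegative f in the kernel of theta were bounded below by e > 0 on K,
    then g^4 <= N f g^2 + g^2 / 4 everywhere, with N = |g|^2 / e, and applying
    theta would give 1 <= 1/4. So the sets of points of K where a nonnegative
    kernel element is small generate a proper filter, and a cluster point x of
    it in K is a common zero of the kernel. Since f - theta(f) g lies in the
    kernel, f(x) = theta(f) g(x), and f = g^2 yields g(x) = 1. *)
Lemma real_character_eval :
  exists x, forall f, C0_real f -> theta f = complex.Re (f x).
Proof.
have [g gR g1] : exists2 g, C0_real g & theta g = 1.
  have [_ _ [g gR g0]] := character.
  exists (C0_scale ((theta g)^-1)%:C g); first exact: C0_realZ.
  by rewrite thetaZ// mulVf.
pose K := [set x | 2^-1 <= normc (g x)].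
have cK : compact K by apply: C0_vanishes; rewrite invr_gt0.
pose good f := [/\ C0_real f, theta f = 0 & forall x, 0 <= complex.Re (f x)].
pose F : set_system X := [set A | exists2 f, good f & exists2 e : R, 0 < e &
  forall x, K x -> complex.Re (f x) < e -> A x].
have meetK f e : good f -> 0 < e -> exists2 x, K x & complex.Re (f x) < e.
  move=> [fR f0 fge0] e0; apply: contrapT => noK.
  pose N := C0_norm g ^+ 2 / e; pose gg := C0_mul g g.
  have ggR : C0_real gg by exact: C0_realM.
  have fgR : C0_real (C0_mul f gg) by exact: C0_realM.
  have sR : C0_real (C0_mul gg gg) by exact: C0_realM.
  have gg1 : theta gg = 1 by rewrite thetaM// g1 mulr1.
  suff : theta (C0_mul gg gg) <=
      theta (C0_scale N%:C (C0_mul f gg) + C0_scale (4^-1)%:C gg).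
    rewrite thetaD ?thetaZ// ?thetaM// ?gg1 ?g1 ?f0
      ?(mul0r, mulr0, mul1r, add0r); [lra|exact: C0_realZ..].
  apply: theta_le => // [|x]; first by apply: C0_realD; exact: C0_realZ.
  rewrite C0_Re_add !C0_Re_scale !C0_Re_mul//.
  set a := complex.Re (g x); set b := complex.Re (f x).
  have a2 : 0 <= a * a by rewrite -expr2 sqr_ge0.
  have N0 : 0 <= N by rewrite divr_ge0 ?sqr_ge0// ltW.
  rewrite [N * _]mulrA -mulrDl ler_wpM2r//.
  have [xK|xK] := leP 2^-1 (normc (g x)).
    have eb : e <= b.
      by rewrite leNgt; apply/negP => be; apply: noK; exists x.
    have : a * a <= N * b.
      apply: (@le_trans _ _ (N * e)); last by rewrite ler_wpM2l.
      rewrite /N mulfVK ?gt_eqF// -expr2 -real_normK ?num_real//.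
      rewrite lerXn2r ?nnegrE ?normr_ge0 ?C0_norm_ge0//.
      by rewrite -normc_C0_real// C0_le_norm.
    by move/le_trans; apply; rewrite lerDl invr_ge0.
  have : a * a <= 4^-1.
    rewrite -expr2 -real_normK ?num_real// -normc_C0_real//.
    rewrite (_ : 4^-1 = 2^-1 ^+ 2); last by rewrite exprVn -natrX.
    by rewrite lerXn2r ?nnegrE ?Defs.normc_ge0 ?invr_ge0// ltW.
  by move/le_trans; apply; rewrite lerDr mulr_ge0//; exact: fge0.
have FF : ProperFilter F.
  split.
    by move=> [f fg [e e0 fA]]; have [x xK /(fA _ xK)] := meetK f e fg e0.
  split.
  - exists 0; last by exists 1.
    split; first by apply: C0_realP => x.
      have := thetaZ 0 g gR; rewrite mul0r => <-; congr theta.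
      by apply: C0_ext => x /=; rewrite mul0r.
    by move=> x.
  - move=> A B [f [fR f0 fge] [e e0 fA]] [h [hR h0 hge] [d d0 hB]].
    exists (f + h).
      split; first exact: C0_realD.
        by rewrite thetaD// f0 h0 addr0.
      by move=> x; rewrite C0_Re_add addr_ge0.
    exists (Num.min e d) => [|x xK]; first by rewrite lt_min e0 d0.
    rewrite C0_Re_add lt_min => /andP[fe hd]; split.
      by apply: fA => //; apply: le_lt_trans fe; rewrite lerDl.
    by apply: hB => //; apply: le_lt_trans hd; rewrite lerDr.
  - move=> A B AB [f fg [e e0 fA]]; exists f => //; exists e => // x xK fx.
    exact/AB/fA.
have [x [xK xcl]] : K `&` cluster F !=set0.
  apply: cK; exists (C0_scale 0 g); last by exists 1.
  split; first by apply: (C0_realZ 0).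
    by rewrite (thetaZ 0)// mul0r.
  by move=> x; rewrite (C0_Re_scale 0) mul0r.
have ker0 f : C0_real f -> theta f = 0 -> complex.Re (f x) = 0.
  move=> fR f0; pose q := C0_mul f f.
  have qE z : complex.Re (q z) = complex.Re (f z) ^+ 2.
    by rewrite C0_Re_mul// expr2.
  apply: contrapT => /eqP fx0.
  have qx0 : 0 < complex.Re (q x) by rewrite qE exprn_even_gt0.
  pose d := complex.Re (q x) / 2; have d0 : 0 < d by rewrite divr_gt0.
  have Fq : F [set z | K z /\ complex.Re (q z) < d].
    exists q; last by exists d.
    split; [exact: C0_realM|by rewrite thetaM// f0 mul0r|].
    by move=> z; rewrite qE sqr_ge0.
  have Nq : nbhs x [set z | d < complex.Re (q z)].
    apply: (@continuous_C0_Re _ _ q x [set r | d < r]).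
    by apply: lt_nbhsr; rewrite /d ltr_pdivrMr// mulr_natr mulr2n ltrDl.
  have [z [[_ zlt] zgt]] := xcl _ _ Fq Nq.
  by have := lt_trans zlt zgt; rewrite ltxx.
have eval f : C0_real f -> complex.Re (f x) = theta f * complex.Re (g x).
  move=> fR; have := ker0 (f + C0_scale (- theta f)%:C g).
  rewrite thetaD// ?thetaZ//; try exact: C0_realZ.
  rewrite g1 mulr1 subrr C0_Re_add C0_Re_scale mulNr => /(_ _ erefl) /eqP.
  rewrite subr_eq0 => /(_ _)/eqP; apply.
  by apply: C0_realD => //; exact: C0_realZ.
exists x => f fR; rewrite eval//.
have gx0 : complex.Re (g x) != 0.
  apply/eqP => gx0; move: xK; rewrite /K /= normc_C0_real// gx0 normr0.
  by rewrite leNgt invr_gt0 ltr0n.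
have := eval (C0_mul g g) (C0_realM _ _ gR gR).
rewrite thetaM// g1 mulr1 mul1r C0_Re_mul// => /(canRL (mulfK gx0)) ->.
by rewrite mulfV// mulr1.
Qed.

End real_character.

(** * Functionals multiplicative in modulus *)

Definition dotc {R : realType} (z w : R[i]) : R :=
  complex.Re z * complex.Re w + complex.Im z * complex.Im w.

Lemma dotc_normc {R : realType} (z : R[i]) : dotc z z = normc z ^+ 2.
Proof.
case: z => a b; rewrite /dotc /= sqr_sqrtr ?addr_ge0 ?sqr_ge0//.
Qed.

Lemma dotc_polarization {R : realType} {U : zmodType} {a b : U -> R[i]}
    {c : R} :
  (forall f g, a (f + g) = a f + a g) -> (forall f g, b (f + g) = b f + b g) ->
  (forall f, normc (a f) = c * normc (b f)) ->
  forall f g, dotc (a f) (a g) = c ^+ 2 * dotc (b f) (b g).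
Proof.
move=> aD bD ab f g.
have sq h : dotc (a h) (a h) = c ^+ 2 * dotc (b h) (b h).
  by rewrite !dotc_normc ab exprMn.
have := sq (f + g); have := sq f; have := sq g; rewrite aD bD /dotc !raddfD /=.
lra.
Qed.

Definition conj_unless {R : realType} (s : bool) (z : R[i]) : R[i] :=
  if s then z else conjc z.

Section functional.
Context {R : realType} {X : topologicalType}.
Implicit Types f g h : C0 R X.

Definition normc_star_multiplicative (tau : C0 R X -> R[i]) :=
  [/\ forall f g, tau (f + g) = tau f + tau g,
      forall f g, normc (tau (C0_mul f g)) = normc (tau f) * normc (tau g) &
      forall f, normc (tau (C0_conj f)) = normc (tau f)].

(** Polarization turns the three modulus identities into
      <tau (k f), tau (k h)> = |tau k|^2 <tau f, tau h>,
      <tau (conj f), tau (conj h)> = <tau f, tau h>,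
      <tau (i f), tau (i h)> = <tau f, tau h>.
    The second one makes tau f and tau (i h) orthogonal for real f and h, since
    conj (i h) = - i h.  As tau (g g) is real and nonzero, tau is thus real on real
    functions and imaginary on i times real functions.  The first identity,
    used with k = g and then with arbitrary k, makes tau multiplicative on real
    functions; the third one compares the two restrictions up to a sign. *)
Lemma normalized_functional_eval (tau : C0 R X -> R[i]) g (t : R) :
  normc_star_multiplicative tau -> C0_real g -> 0 < t ->
  tau (C0_mul g g) = t%:C ->
  exists x s, forall f, tau f = conj_unless s (f x).
Proof.
move=> [tauD tauM tauC] gR t0 tgg.
have tau0 : tau 0 = 0 by apply: (addrI (tau 0)); rewrite -tauD !addr0.
have tauN f : tau (- f) = - tau f.
  by apply/eqP; rewrite -subr_eq0 opprK -tauD addNr tau0.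
pose I f := C0_scale 'i f.
have tauI f : normc (tau (I f)) = 1 * normc (tau f).
  rewrite mul1r; apply/eqP.
  rewrite -(@eqrXn2 _ 2)// ?Defs.normc_ge0// !expr2 -!tauM.
  rewrite (_ : C0_mul (I f) (I f) = - C0_mul f f) ?tauN ?normcN//.
  apply: C0_ext => x; rewrite -[RHS]/(- (f x * f x)) /=.
  by case: (f x) => a b; simpc; congr (_ +i* _); ring.
have ID f h : I (f + h) = I f + I h.
  by apply: C0_ext => x; exact: (mulrDr 'i (f x) (h x)).
have dotI f h : dotc (tau (I f)) (tau (I h)) = dotc (tau f) (tau h).
  rewrite (dotc_polarization (a := tau \o I) _ tauD tauI) ?expr1n ?mul1r//.
  by move=> u v /=; rewrite ID tauD.
have dotM k f h : dotc (tau (C0_mul k f)) (tau (C0_mul k h)) =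
    normc (tau k) ^+ 2 * dotc (tau f) (tau h).
  apply: (dotc_polarization (a := tau \o C0_mul k) _ tauD (tauM k)) => u v /=.
  by rewrite -tauD; congr tau; apply: C0_ext => x; exact: (mulrDr (k x)).
have orth f h : C0_real f -> C0_real h -> dotc (tau f) (tau (I h)) = 0.
  move=> fR hR.
  have : dotc (tau (C0_conj f)) (tau (C0_conj (I h))) =
      dotc (tau f) (tau (I h)).
    rewrite (dotc_polarization (a := tau \o C0_conj) (c := 1) _ tauD).
    - by rewrite expr1n mul1r.
    - by move=> u v /=; rewrite C0_conjD tauD.
    - by move=> u; rewrite mul1r /= tauC.
  rewrite fR (_ : C0_conj (I h) = - I h); last first.
    apply: C0_ext => x; rewrite -[RHS]/(- ('i * h x)) /= (C0_realE hR).
    by simpc.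
  by rewrite tauN /dotc !raddfN /=; lra.
have ReI f : C0_real f -> complex.Re (tau (I f)) = 0.
  move=> fR; have := orth _ _ (C0_realM _ _ gR gR) fR.
  rewrite tgg /dotc /= mul0r addr0 => /eqP.
  by rewrite mulf_eq0 gt_eqF//= => /eqP.
have ImT f : C0_real f -> complex.Im (tau f) = 0.
  move=> fR; have ggR := C0_realM _ _ gR gR.
  have := orth _ _ fR ggR; rewrite /dotc ReI// mulr0 add0r => /eqP.
  rewrite mulf_eq0 => /orP[/eqP//|/eqP tI0].
  have /eqP := tauI (C0_mul g g); rewrite mul1r tgg normc_real.
  suff -> : tau (I (C0_mul g g)) = 0 by rewrite normc0 eq_sym normr_eq0 gt_eqF.
  by apply/eqP; rewrite eq_complex ReI// tI0 /= eqxx.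
pose theta f := complex.Re (tau f); pose eta f := complex.Im (tau (I f)).
have tauR f : C0_real f -> tau f = (theta f)%:C.
  by move=> fR; apply/eqP; rewrite eq_complex /= ImT// !eqxx.
have etaM f h : C0_real f -> C0_real h -> eta f * eta h = theta f * theta h.
  move=> fR hR; have := dotI f h; rewrite /dotc !ReI// (ImT f)// (ImT h)//.
  by rewrite !mulr0 add0r addr0.
have thetaM3 k f h : C0_real k -> C0_real f -> C0_real h ->
    theta (C0_mul k f) * theta (C0_mul k h) =
      theta k ^+ 2 * (theta f * theta h).
  move=> kR fR hR; have := dotM k f h.
  have kfR := C0_realM _ _ kR fR; have khR := C0_realM _ _ kR hR.
  rewrite -dotc_normc /dotc !ImT// !mulr0 !addr0 -expr2; exact.
have thgg : theta (C0_mul g g) = theta g ^+ 2.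
  have := tauM g g.
  rewrite tgg tauR// !normc_real -expr2 real_normK ?num_real//.
  by rewrite /theta tgg gtr0_norm.
have thg0 : theta g != 0.
  by apply/eqP => thg; have := t0; rewrite -[t]/(complex.Re t%:C) -tgg
    -[complex.Re _]/(theta _) thgg thg expr0n /= ltxx.
(* thetaM3 alone leaves a sign, which the value theta (g g) > 0 fixes *)
have thetaMg f : C0_real f -> theta (C0_mul g f) = theta g * theta f.
  move=> fR; have := thetaM3 g f g gR fR gR; rewrite thgg => /eqP.
  rewrite [X in X == _]mulrC -subr_eq0 -mulrBr mulf_eq0 expf_eq0.
  by rewrite (negbTE thg0) /= subr_eq0 => /eqP ->; rewrite mulrC.
have thetaM f h : C0_real f -> C0_real h ->
    theta (C0_mul f h) = theta f * theta h.
  move=> fR hR; have [f0|f0] := eqVneq (theta f) 0.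
    have fhR := C0_realM _ _ fR hR.
    have /eqP := tauM f h; rewrite !tauR// !normc_real f0 normr0 !mul0r.
    by rewrite normr_eq0 => /eqP.
  have := thetaM3 f h g fR hR gR.
  have -> : C0_mul f g = C0_mul g f by apply: C0_ext => x /=; rewrite mulrC.
  rewrite thetaMg// => E; apply: (mulIf (mulf_neq0 thg0 f0)); rewrite E; ring.
have [x thx] : exists x, forall f, C0_real f -> theta f = complex.Re (f x).
  apply: real_character_eval; split; [|by []|by exists g].
  by move=> f h fR hR; rewrite /theta tauD raddfD.
exists x, (eta g == theta g) => f.
have etas h : C0_real h ->
    eta h = if eta g == theta g then theta h else - theta h.
  move=> hR; have := etaM h g hR gR; have := etaM g g gR gR => /eqP.
  rewrite -!expr2 eqf_sqr; case: eqVneq => /= [-> _ /(mulIf thg0)//|_ /eqP ->].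
  by rewrite mulrN -mulNr => /(mulIf thg0) <-; rewrite opprK.
have [a [b [aR bR ->]]] := C0_cartesian f.
have -> : tau (a + C0_scale 'i b) = theta a +i* eta b.
  rewrite tauD; apply/eqP; rewrite eq_complex !raddfD /= -/(I b) ReI// ImT//.
  by rewrite addr0 add0r !eqxx.
rewrite C0_addE /= (C0_realE aR x) (C0_realE bR x) -!thx// etas// /conj_unless.
by case: ifP => _ /=; simpc.
Qed.

(** A rotation reduces to the normalized case: for f0 with tau f0 nonzero the
    function g = f0 conj f0 is real, tau (g g) is nonzero, and dividing tau by
    the phase of tau (g g) makes that value positive. *)
Lemma functional_eval (tau : C0 R X -> R[i]) :
  normc_star_multiplicative tau -> (exists f, tau f != 0) ->
  exists w x s, normc w = 1 /\ forall f, tau f = w * conj_unless s (f x).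
Proof.
move=> [tauD tauM tauC] [f0 tf0].
have norm0 z : (normc z == 0 :> R) = (z == 0).
  by apply/eqP/eqP => [/eq0_normc//|->]; rewrite normc0.
pose g := C0_mul f0 (C0_conj f0).
have gR : C0_real g.
  rewrite /C0_real C0_conjM C0_conjK; apply: C0_ext => x; exact: mulrC.
pose r := normc (tau (C0_mul g g)).
have r0 : 0 < r.
  by rewrite lt_def Defs.normc_ge0 andbT /r !tauM tauC !mulf_neq0 ?norm0.
pose w := tau (C0_mul g g) / r%:C.
have wr : w * r%:C = tau (C0_mul g g).
  by rewrite /w mulfVK// (fmorph_eq0 (real_complex R)) gt_eqF.
have w1 : normc w = 1.
  have /eqP := congr1 (@normc R) wr; rewrite normcM normc_real gtr0_norm// -/r.
  by rewrite -[X in _ == X]mul1r => /eqP/mulIf; apply; rewrite gt_eqF.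
have w0 : w != 0 by rewrite -norm0 w1 oner_eq0.
have nw z : normc (w^-1 * z) = normc z by rewrite normcM normcV w1 invr1 mul1r.
have [x [s E]] : exists x s, forall f, w^-1 * tau f = conj_unless s (f x).
  apply: (@normalized_functional_eval (fun f => w^-1 * tau f) g r) => //.
    split=> [f h|f h|f]; rewrite ?nw//; first by rewrite tauD mulrDr.
  by rewrite -wr mulKf.
by exists w, x, s; split=> // f; rewrite -E mulVKf.
Qed.

End functional.

(** * From norms to pointwise moduli *)

Lemma C0_half {R : realType} {X : topologicalType} (f : C0 R X) :
  exists h, h *+ 2 = f.
Proof.
exists (C0_scale (2^-1) f); apply: C0_ext => x.
by rewrite C0_mulrnE mulr2n [RHS]splitr /= mulrC.
Qed.

Lemma C0_double_inj {R : realType} {X : topologicalType} (f g : C0 R X) :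
  f *+ 2 = g *+ 2 -> f = g.
Proof.
move=> fg; apply/eqP; rewrite -subr_eq0 -normr_eq0.
have : `|f - g| *+ 2 == 0 by rewrite -normrMn mulrnBl fg subrr normr0.
by rewrite mulrn_eq0.
Qed.

Lemma C0_near_neq0 {R : realType} {X : topologicalType} (f : C0 R X) x :
  f x != 0 -> \forall z \near x, f z != 0.
Proof.
move=> fx; have n0 : 0 < normc (f x).
  by rewrite lt_def Defs.normc_ge0 andbT; apply: contra fx => /eqP/eq0_normc ->.
have nb : nbhs (f x) [set t : R[i] | 0 < normc t].
  by apply: (@continuous_normc R (f x) [set r | 0 < r]); exact: lt_nbhsr.
apply: (@filterS _ (nbhs x)) (@C0_continuous _ _ f x _ nb) => z /=.
by apply: contraTneq => ->; rewrite normc0 ltxx.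
Qed.

Lemma closed_normc_near {R : realType} {X : topologicalType} (f : C0 R X) c e :
  closed [set z | `|normc (f z) - c| <= e].
Proof.
rewrite -[X in closed X]/((fun z => `|normc (f z) - c|) @^-1` [set r | r <= e]).
apply: preimage_closed; last exact: closed_le.
move=> z _; apply: cvg_norm; apply: cvgB; last exact: cvg_cst.
by apply: continuous_comp; [exact: C0_continuous|exact: continuous_normc].
Qed.

Lemma nbhs_normc_near {R : realType} {X : topologicalType} (f : C0 R X) y e :
  0 < e -> nbhs y [set z | `|normc (f z) - normc (f y)| <= e].
Proof.
move=> e0; have cf : (fun z => normc (f z)) @ y --> normc (f y).
  apply: (@continuous_comp _ _ _ f (@normc R)); first exact: C0_continuous.
  exact: continuous_normc.
have /(iffLR (@cvgrPdist_lt _ _ _ (nbhs y) _ _ _)) /(_ e e0) := cf.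
by apply: filterS => z /ltW; rewrite distrC.
Qed.

(** Multiplying by u scales the norm of v by about c when |u| is within e of c
    on the set where v is nonzero. *)
Lemma C0_norm_mul_near {R : realType} {X : topologicalType} (u v : C0 R X)
    (c e : R) : 0 <= c -> 0 <= e ->
  (forall z, v z != 0 -> `|normc (u z) - c| <= e) ->
  `| `|C0_mul u v| - c * `|v| | <= e * `|v|.
Proof.
move=> c0 e0 ue.
have bound z : `|normc (u z * v z) - c * normc (v z)| <= e * normc (v z).
  rewrite normcM -mulrBl normrM (ger0_norm (Defs.normc_ge0 _)).
  have [->|/ue vz] := eqVneq (v z) 0; first by rewrite normc0 !mulr0.
  by rewrite ler_wpM2r ?Defs.normc_ge0.
have up : `|C0_mul u v| <= (c + e) * `|v|.
  apply: C0_norm_le => [|z]; first by rewrite mulr_ge0 ?addr_ge0.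
  apply: (@le_trans _ _ ((c + e) * normc (v z))).
    by have := bound z; rewrite ler_norml /= => /andP[_]; lra.
  by apply: ler_wpM2l; [exact: addr_ge0|exact: C0_le_norm].
have down : c * `|v| <= `|C0_mul u v| + e * `|v|.
  have [->|cn0] := eqVneq c 0.
    by rewrite mul0r addr_ge0// mulr_ge0.
  have cp : 0 < c by rewrite lt_def cn0.
  rewrite mulrC -ler_pdivlMr//; apply: C0_norm_le => [|z].
    by rewrite divr_ge0// addr_ge0// mulr_ge0.
  rewrite ler_pdivlMr// mulrC.
  have := bound z; rewrite ler_norml => /andP[lo _].
  have uvz := C0_le_norm (C0_mul u v) z; rewrite /= in uvz.
  have := ler_wpM2l e0 (C0_le_norm v z).
  rewrite -[C0_norm v]/(`|v|); rewrite -[C0_norm _]/(`|C0_mul u v|) in uvz.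
  lra.
by rewrite ler_norml; apply/andP; split; lra.
Qed.

Lemma small_multiples_eq0 {R : realType} (x C : R) : 0 <= C ->
  (forall e, 0 < e -> e <= 1 -> `|x| <= e * C) -> x = 0.
Proof.
move=> C0 xC; apply/eqP; rewrite -normr_le0 leNgt; apply/negP => x0.
have C1 : 0 < C + 1 by rewrite ltr_wpDl.
pose e := Num.min 1 (`|x| / (C + 1)).
have e0 : 0 < e by rewrite lt_min ltr01 divr_gt0.
have e1 : e <= 1 by rewrite ge_min lexx.
have : e * (C + 1) <= `|x| by rewrite -ler_pdivlMr// ge_min lexx orbT.
have := xC e e0 e1; lra.
Qed.

Section norm_isomorphism.
Context {R : realType} {X Y : topologicalType}.
Variable T : C0 R X -> C0 R Y.
Hypothesis isoT : ring_isomorphism_in_norm T.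
Hypothesis conjT : forall f, `|T (C0_conj f)| = `|T f|.

Lemma ring_isomorphism_in_norm_additive f g : T (f + g) = T f + T g.
Proof.
case: isoT => bT nD _.
exact: (norm_additive_additive (@C0_half R X) (@C0_half R Y)
  (@C0_double_inj R X)).
Qed.

Let TD := ring_isomorphism_in_norm_additive.

Let TM f g : `|T (C0_mul f g)| = `|C0_mul (T f) (T g)|.
Proof. by case: isoT. Qed.

Let T0 : T 0 = 0.
Proof. by apply: (addrI (T 0)); rewrite -TD !addr0. Qed.

Let Tinj : injective T.
Proof. by case: isoT => /bij_inj. Qed.

(** Zero products are visible to the norm, because T is injective and T 0 = 0.
    *)
Lemma disjoint_image f g : C0_mul (T f) (T g) = 0 <-> C0_mul f g = 0.
Proof.
split=> [Tfg|fg].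
  apply: Tinj; apply/eqP; rewrite T0 -normr_eq0 TM Tfg normr0//.
by apply/eqP; rewrite -normr_eq0 -TM fg T0 normr0.
Qed.

Hypothesis Y_lc : locally_compact [set: Y].
Hypothesis Y_hausdorff : hausdorff_space Y.

(** The annihilator of a function determines the closure of its support, and T
    transports annihilators by [disjoint_image]. *)
Lemma image_support_le a b (V : set Y) : closed V ->
  (forall m, C0_mul m a = 0 -> C0_mul m b = 0) ->
  (forall z, ~ V z -> T a z = 0) -> forall z, ~ V z -> T b z = 0.
Proof.
move=> clV ab Ta z nVz.
have zV : nbhs z (~` V).
  by apply: open_nbhs_nbhs; split=> //; exact: closed_openC.
have [v [_ vz vV]] := C0_bump (R := R) z (~` V) Y_lc Y_hausdorff zV.
have [T' _ T'K] : bijective T by case: isoT.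
have ma : C0_mul (T' v) a = 0.
  apply/disjoint_image; rewrite T'K; apply: C0_ext => t /=.
  have [Vt|/Ta ->] := pselect (V t); last by rewrite mulr0.
  by rewrite vV ?mul0r// => /(_ Vt).
have /disjoint_image := ab _ ma; rewrite T'K => vb.
have := congr1 (fun h : C0 R Y => h z) vb; rewrite /= vz mul1r; exact.
Qed.

(** The image of k is a bump at y, supported where each u in us varies in
    modulus by at most e. On images supported there, multiplication by u = T c
    acts on norms almost as the scalar |u(y)|; the condition on b, that it is
    killed by every annihilator of k, keeps the image of b inside that support.
    *)
Lemma localization y (e : R) (us : seq (C0 R Y)) : 0 < e ->
  exists k, [/\ 0 < `|T k| &
    forall b c, (forall m, C0_mul m k = 0 -> C0_mul m b = 0) -> T c \in us ->
    `| `|T (C0_mul c b)| - normc (T c y) * `|T b| | <= e * `|T b| ].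
Proof.
move=> e0.
pose V := [set z | forall u, u \in us -> `|normc (u z) - normc (u y)| <= e].
have [clV Vy] : closed V /\ nbhs y V.
  rewrite /V; elim: us {V} => [|u us [IHc IHn]].
    rewrite (_ : [set z | _] = setT); last by apply/seteqP; split.
    by split; [exact: closedT|exact: filterT].
  rewrite (_ : [set z | _] = [set z | `|normc (u z) - normc (u y)| <= e] `&`
      [set z | forall u, u \in us -> `|normc (u z) - normc (u y)| <= e]).
    split; first by apply: closedI => //; exact: closed_normc_near.
    by apply: filterI => //; exact: nbhs_normc_near.
  apply/seteqP; split=> z /=.
    move=> H; split; first by apply: H; rewrite mem_head.
    by move=> t tus; apply: H; rewrite inE tus orbT.
  by move=> [Hu Hus] t; rewrite inE => /orP[/eqP ->//|/Hus].
have [k0 [_ k0y k0V]] := C0_bump (R := R) y V Y_lc Y_hausdorff Vy.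
have [T' _ T'K] : bijective T by case: isoT.
exists (T' k0); rewrite T'K; split.
  rewrite normr_gt0; apply/eqP => k00; move: k0y; rewrite k00 => /eqP.
  by rewrite eq_sym oner_eq0.
move=> b c kb cus; rewrite TM.
apply: C0_norm_mul_near; [exact: Defs.normc_ge0|exact: ltW|move=> z bz].
have : V z; last exact.
apply: contrapT => nVz; move/eqP: bz; apply.
apply: (image_support_le (T' k0) b V clV kb _ z nVz) => t.
by rewrite T'K; exact: k0V.
Qed.

(** With k localized at y, |T (f g k)| is about |T (f g)(y)| |T k|, and also
    about |T f (y)| |T (g k)|, hence about |T f (y)| |T g (y)| |T k|. *)
Lemma image_normcM y f g :
  normc (T (C0_mul f g) y) = normc (T f y) * normc (T g y).
Proof.
set P := normc _; set F := normc _; set G := normc _.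
have F0 : 0 <= F := Defs.normc_ge0 _; have G0 : 0 <= G := Defs.normc_ge0 _.
apply/eqP; rewrite -subr_eq0; apply/eqP.
apply: (small_multiples_eq0 _ (2 + F + G)); first by rewrite !addr_ge0.
move=> e e0 e1.
have [k [k0 H]] := localization y e [:: T f; T g; T (C0_mul f g)] e0.
have gk m : C0_mul m k = 0 -> C0_mul m (C0_mul g k) = 0.
  move=> mk; apply: C0_ext => z /=; rewrite mulrCA.
  by rewrite -[m z * k z]/(C0_mul m k z) mk mulr0.
have := H k (C0_mul f g) (fun _ => id); have := H k g (fun _ => id).
have := H (C0_mul g k) f gk; rewrite !inE !eqxx !orbT /=.
have -> : C0_mul f (C0_mul g k) = C0_mul (C0_mul f g) k.
  by apply: C0_ext => z /=; rewrite mulrA.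
move=> /(_ isT) + /(_ isT) + /(_ isT).
rewrite -/P -/F -/G; set n := `|T k| in k0 *; set m := `|T (C0_mul g k)|.
set p := `|T (C0_mul (C0_mul f g) k)| => pm mn pn.
rewrite -(ler_pM2r k0) -[X in _ * X <= _](gtr0_norm k0) -normrM.
have -> : (P - F * G) * n =
    - (p - P * n) + (p - F * m) + F * (m - G * n) by ring.
apply: (le_trans (ler_normD _ _)); rewrite normrM (ger0_norm F0).
have := ler_normD (- (p - P * n)) (p - F * m); rewrite normrN.
have := ler_wpM2l F0 mn.
have : m <= (1 + G) * n.
  have en : e * n <= 1 * n by rewrite ler_wpM2r// ltW.
  by have := ler_norm (m - G * n); lra.
move=> /(ler_wpM2l (ltW e0)); lra.
Qed.

(** With k localized at y, |T (conj f k)| is about |T (conj f)(y)| |T k|; its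
    conjugate argument gives |T (f conj k)|, about |T f (y)| |T (conj k)|, and
    |T (conj k)| = |T k|. *)
Lemma image_normc_conj y f : normc (T (C0_conj f) y) = normc (T f y).
Proof.
set P := normc _; set F := normc _; apply/eqP; rewrite -subr_eq0; apply/eqP.
apply: (small_multiples_eq0 _ 2) => // e e0 e1.
have [k [k0 H]] := localization y e [:: T (C0_conj f); T f] e0.
have ck m : C0_mul m k = 0 -> C0_mul m (C0_conj k) = 0.
  move=> mk; apply: C0_ext => z /=.
  have /eqP := congr1 (fun h : C0 R X => h z) mk; rewrite /= mulf_eq0.
  by case/orP => /eqP ->; rewrite ?mul0r// conjc0 mulr0.
have := H k (C0_conj f) (fun _ => id); have := H (C0_conj k) f ck.
rewrite !inE !eqxx !orbT /= => /(_ isT) + /(_ isT).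
have -> : `|T (C0_mul f (C0_conj k))| = `|T (C0_mul (C0_conj f) k)|.
  by rewrite -conjT C0_conjM C0_conjK.
rewrite -/P -/F conjT; set n := `|T k| in k0 *.
set p := `|T (C0_mul (C0_conj f) k)| => pF pP.
rewrite -(ler_pM2r k0) -[X in _ * X <= _](gtr0_norm k0) -normrM.
have -> : (P - F) * n = (p - F * n) - (p - P * n) by ring.
by apply: (le_trans (ler_normB _ _)); lra.
Qed.

Lemma image_pointwise y :
  exists w x s, normc w = 1 /\ forall f, T f y = w * conj_unless s (f x).
Proof.
apply: functional_eval.
  split=> [f g|f g|f]; [by rewrite TD|exact: image_normcM|].
  exact: image_normc_conj.
have [v [_ vy _]] := C0_bump (R := R) y setT Y_lc Y_hausdorff filterT.
have [T' _ T'K] : bijective T by case: isoT.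
by exists (T' v); rewrite T'K vy oner_eq0.
Qed.

End norm_isomorphism.

(** * Weighted compositions *)

Lemma normc_conj_unless {R : realType} s (z : R[i]) :
  normc (conj_unless s z) = normc z.
Proof. by case: s; rewrite //= normc_conj. Qed.

(** The inverse of z |-> c z is multiplication by conj c, while z |-> c conj z
    is its own inverse. *)
Lemma conj_unlessK {R : realType} b (c z : R[i]) : normc c = 1 ->
  conj_unless (~~ b) c * conj_unless b (c * conj_unless b z) = z /\
  c * conj_unless b (conj_unless (~~ b) c * conj_unless b z) = z.
Proof.
move=> c1; have cc : c * conjc c = 1.
  by rewrite -sqr_normc /Num.norm /= c1 expr1n.
have cK x : c * (conjc c * x) = x by rewrite mulrA cc mul1r.
by case: b => /=; split; rewrite ?[conjc (_ * _)]rmorphM /= ?conjcK// mulrCA.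
Qed.

Lemma normc_eq0 {R : realType} (z : R[i]) : (normc z == 0) = (z == 0).
Proof. by apply/eqP/eqP => [/eq0_normc//|->]; rewrite normc0. Qed.

Lemma C0_norm_eq {R : realType} {X : topologicalType} (f g : C0 R X) :
  (forall x, normc (f x) = normc (g x)) -> `|f| = `|g|.
Proof.
move=> fg; rewrite !C0_normE (_ : (fun x => normc (f x)) = @normc R \o g)//.
exact/funext.
Qed.

Definition weighted_composition {R : realType} {X Y : topologicalType}
    (T : C0 R X -> C0 R Y) (w : Y -> R[i]) (phi : Y -> X) (s : Y -> bool) :=
  (forall y, normc (w y) = 1) /\
  forall f y, T f y = w y * conj_unless (s y) (f (phi y)).

Section weighted_composition.
Context {R : realType} {X Y : topologicalType}.
Variables (T : C0 R X -> C0 R Y) (w : Y -> R[i]) (phi : Y -> X) (s : Y -> bool).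
Hypothesis TE : weighted_composition T w phi s.

Lemma weighted_composition_normc f y : normc (T f y) = normc (f (phi y)).
Proof. by case: TE => w1 ->; rewrite normcM w1 mul1r normc_conj_unless. Qed.

Lemma weighted_composition_neq0 f y : (T f y != 0) = (f (phi y) != 0).
Proof. by rewrite -normc_eq0 weighted_composition_normc normc_eq0. Qed.

Hypothesis X_lc : locally_compact [set: X].
Hypothesis X_hausdorff : hausdorff_space X.

Lemma weighted_composition_symbol_continuous : continuous phi.
Proof.
move=> y U Uy; have [u [_ uy uU]] := C0_bump (R := R) _ U X_lc X_hausdorff Uy.
have Ty : T u y != 0 by rewrite weighted_composition_neq0 uy oner_eq0.
apply: (@filterS _ (nbhs y)) (C0_near_neq0 _ _ Ty) => z /=.
rewrite weighted_composition_neq0 => uz; apply: contrapT => /uU /eqP.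
by rewrite (negbTE uz).
Qed.

Let unit_bump y : exists u : C0 R X, C0_real u /\ u (phi y) = 1.
Proof.
have [u [uR uy _]] := C0_bump (R := R) (phi y) setT X_lc X_hausdorff filterT.
by exists u.
Qed.

Lemma weighted_composition_weight_continuous : continuous w.
Proof.
move=> y; have [u [uR uy]] := unit_bump y.
have cphi := weighted_composition_symbol_continuous.
have cu : (fun z => u (phi z)) @ y --> u (phi y).
  apply: (@continuous_comp _ _ _ phi u); first exact: cphi.
  exact: C0_continuous.
have uy0 : u (phi y) != 0 by rewrite uy oner_eq0.
have cq : (fun z => T u z * (u (phi z))^-1) @ y --> T u y * (u (phi y))^-1.
  by apply: cvgM; [exact: C0_continuous|exact: cvgV].
have wE z : u (phi z) != 0 -> T u z * (u (phi z))^-1 = w z.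
  move=> uz; case: TE => _ ->.
  rewrite (_ : conj_unless _ _ = u (phi z)) ?mulfK//.
  by case: (s z) => //=; rewrite (C0_realE uR) conjc_real.
change (w @ y --> w y); rewrite -(wE y uy0).
apply: cvg_trans cq; apply: near_eq_cvg.
have Ty : T u y != 0 by rewrite weighted_composition_neq0.
apply: (@filterS _ (nbhs y)) (C0_near_neq0 _ _ Ty) => z /=.
by rewrite weighted_composition_neq0 => /wE.
Qed.

(** For u real with u (phi y) = 1, the functions T (i u) - i T u and T (i u) +
    i T u are continuous and nonzero at y exactly when s y is false,
    respectively true. *)
Lemma weighted_composition_side_clopen : clopen [set y | s y].
Proof.
have w0 y : w y != 0 by rewrite -normc_eq0; case: TE => -> _; rewrite oner_eq0.
have side (c : R[i]) (b : bool) :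
    (forall z, (s z == b) = (c != - conj_unless (s z) 'i)) ->
    open [set z | s z == b].
  move=> cE; rewrite openE => y /= sy; have [u [uR uy]] := unit_bump y.
  pose v := T (C0_scale 'i u) + C0_scale c (T u).
  have vE z : (v z != 0) = (s z == b) && (u (phi z) != 0).
    rewrite C0_addE /=; case: TE => _ TuE; rewrite !TuE /=.
    rewrite cE; set k := conj_unless (s z) 'i.
    have -> : conj_unless (s z) ('i * u (phi z)) = k * u (phi z).
      rewrite /k; case: (s z) => //=.
      by rewrite (C0_realE uR); simpc.
    have -> : conj_unless (s z) (u (phi z)) = u (phi z).
      by case: (s z) => //=; rewrite (C0_realE uR) conjc_real.
    rewrite (_ : _ + _ = w z * (c + k) * u (phi z)); last by ring.
    by rewrite !mulf_eq0 (negbTE (w0 z)) /= negb_or addr_eq0.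
  have vy : v y != 0 by rewrite vE sy uy oner_eq0.
  apply: (@filterS _ (nbhs y)) (C0_near_neq0 _ _ vy) => z /=.
  by rewrite vE => /andP[].
have iN : 'i != - 'i :> R[i].
  by rewrite -addr_eq0 eq_complex /= addr0 eqxx -mulr2n mulrn_eq0 oner_eq0.
have conji : conjc 'i = - 'i :> R[i].
  by apply/eqP; rewrite eq_complex /= oppr0 !eqxx.
split.
  rewrite (_ : [set y | _] = [set y | s y == true]).
    apply: (side 'i) => z; rewrite /conj_unless.
    case: (s z); first by rewrite iN.
    by rewrite conji opprK eqxx.
  by apply/seteqP; split => y /= /eqP.
rewrite -openC (_ : ~` _ = [set y | s y == false]).
  apply: (side (- 'i)) => z; rewrite /conj_unless.
  case: (s z); first by rewrite eqxx.
  by rewrite conji opprK eq_sym iN.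
apply/seteqP; split => y /=; first by move/negP/negbTE ->.
by move=> /eqP ->.
Qed.

(** If |f| exceeded |T f| at some x, it would do so on an open set U; a bump
    function in U has a nonzero image, so phi takes a value in U, where |f o
    phi| = |T f| pointwise. *)
Lemma weighted_composition_isometry : injective T -> T 0 = 0 ->
  forall f, `|T f| = `|f|.
Proof.
move=> Tinj T0 f; apply/eqP; rewrite eq_le; apply/andP; split.
  apply: C0_norm_le => // y; rewrite weighted_composition_normc.
  exact: C0_le_norm.
apply: C0_norm_le => // x; rewrite leNgt; apply/negP => fx.
have Ux : nbhs x [set z | `|T f| < normc (f z)].
  apply: (@continuous_comp _ _ _ f (@normc R) x _ _ [set r | `|T f| < r]).
  - exact: C0_continuous.
  - exact: continuous_normc.
  - exact: lt_nbhsr.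
have [u [_ ux uU]] := C0_bump (R := R) x _ X_lc X_hausdorff Ux.
have : T u <> 0.
  rewrite -T0 => /Tinj u0; move: ux; rewrite u0 => /eqP.
  by rewrite eq_sym oner_eq0.
apply; apply: C0_ext => y; apply/eqP; apply: contraT.
rewrite weighted_composition_neq0 => /eqP uy.
have : `|T f| < normc (f (phi y)) by apply: contrapT => /uU.
by rewrite -weighted_composition_normc ltNge C0_le_norm.
Qed.

End weighted_composition.

Lemma normc_separates {R : realType} {X : topologicalType} (x x' : X) :
  locally_compact [set: X] -> hausdorff_space X ->
  (forall f : C0 R X, normc (f x) = normc (f x')) -> x = x'.
Proof.
move=> lc hX fxx'; apply: contrapT => xx'.
have Ux : nbhs x (~` [set x']).
  apply: open_nbhs_nbhs; split=> //; apply: closed_openC.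
  exact/accessible_closed_set1/hausdorff_accessible.
have [u [_ ux uU]] := C0_bump (R := R) x _ lc hX Ux.
have := fxx' u; rewrite ux uU; last by apply.
by rewrite normc0 normc1 => /eqP; rewrite oner_eq0.
Qed.

Lemma norm_isomorphism_weighted {R : realType} {X Y : topologicalType}
    {T : C0 R X -> C0 R Y} :
  locally_compact [set: Y] -> hausdorff_space Y ->
  ring_isomorphism_in_norm T -> (forall f, `|T (C0_conj f)| = `|T f|) ->
  exists w phi s, weighted_composition T w phi s.
Proof.
move=> lc hY isoT conjT.
have [w /choice [phi /choice [s H]]] :=
  choice (image_pointwise T isoT conjT lc hY).
by exists w, phi, s; split=> [y|f y]; have [w1 TE] := H y.
Qed.

(** The hypotheses only involve norms of T-images, so once T is isometric they
    can be read backwards. *)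
Lemma isometric_inverse_isomorphism {R : realType} {X Y : topologicalType}
    {T : C0 R X -> C0 R Y} {T' : C0 R Y -> C0 R X} :
  cancel T T' -> cancel T' T -> (forall f, `|T f| = `|f|) ->
  ring_isomorphism_in_norm T ->
  ring_isomorphism_in_norm T' /\ (forall u, `|T' (C0_conj u)| = `|T' u|).
Proof.
move=> TK T'K normT [_ TD TM].
have normT' u : `|T' u| = `|u| by rewrite -normT T'K.
split; last first.
  by move=> u; rewrite !normT'; apply: C0_norm_eq => y /=; rewrite normc_conj.
split=> [|u v|u v]; first by exists T.
  by rewrite normT' -(normT (T' u + T' v)) TD !T'K.
by rewrite normT' -(normT (C0_mul (T' u) (T' v))) TM !T'K.
Qed.

(** From |T f| = |f o phi| and |T' u| = |u o psi| it follows that |f| = |f o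
    phi o psi| for all f, and moduli separate points. *)
Lemma weighted_composition_homeomorphism {R : realType} {X Y : topologicalType}
    {T : C0 R X -> C0 R Y} {T' : C0 R Y -> C0 R X} {w phi s w' psi s'} :
  locally_compact [set: X] -> hausdorff_space X ->
  locally_compact [set: Y] -> hausdorff_space Y ->
  cancel T T' -> cancel T' T ->
  weighted_composition T w phi s -> weighted_composition T' w' psi s' ->
  homeomorphism phi.
Proof.
move=> Xlc Xh Ylc Yh TK T'K TE T'E; split.
  exact: weighted_composition_symbol_continuous TE Xlc Xh.
exists psi; split.
- move=> y; apply/esym/(normc_separates (R := R) _ _ Ylc Yh) => u.
  rewrite -{1}(T'K u) (weighted_composition_normc _ _ _ _ TE).
  exact: weighted_composition_normc T'E _ _.
- move=> x; apply/esym/(normc_separates (R := R) _ _ Xlc Xh) => f.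
  rewrite -{1}(TK f) (weighted_composition_normc _ _ _ _ T'E).
  exact: weighted_composition_normc TE _ _.
- exact: weighted_composition_symbol_continuous T'E Ylc Yh.
Qed.

Lemma continuous_conj_unless_clopen {R : realType} {Y : topologicalType}
    (A : set Y) (f : Y -> R[i]) : clopen A -> continuous f ->
  continuous (fun y => conj_unless (y \in A) (f y)).
Proof.
move=> [oA cA] cf y.
change ((fun z => conj_unless (z \in A) (f z)) @ y -->
  conj_unless (y \in A) (f y)).
have [Ay|nAy] := boolP (y \in A).
  change ((fun z => conj_unless (z \in A) (f z)) @ y --> f y).
  apply: cvg_trans (cf y); apply: near_eq_cvg.
  have : nbhs y A by apply: open_nbhs_nbhs; split=> //; exact/set_mem.
  by apply: filterS => z /mem_set ->.
have cc : (fun z => conjc (f z)) @ y --> conjc (f y).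
  apply: (@continuous_comp _ _ _ f (@conjc R)); first exact: cf.
  exact: continuous_conjc.
change ((fun z => conj_unless (z \in A) (f z)) @ y --> conjc (f y)).
apply: cvg_trans cc; apply: near_eq_cvg.
have : nbhs y (~` A).
  apply: open_nbhs_nbhs; split; first exact: closed_openC.
  by move=> Ay; move/negP: nAy; apply; exact: mem_set.
by apply: filterS => z nAz; rewrite memNset.
Qed.

Section construction.
Context {R : realType} {X Y : topologicalType}.

(** Vanishing at infinity uses psi: the level sets of the image are the images
    by psi of the compact level sets of f. *)
Lemma weighted_composition_exists (w : Y -> R[i]) (phi : Y -> X) (psi : X -> Y)
    (Y0 : set Y) :
  continuous w -> (forall y, normc (w y) = 1) -> continuous phi ->
  continuous psi -> cancel psi phi -> cancel phi psi -> clopen Y0 ->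
  exists T : C0 R X -> C0 R Y, weighted_composition T w phi (fun y => y \in Y0).
Proof.
move=> cw w1 cphi cpsi psiK phiK Y0c.
have TC0 (f : C0 R X) :
    (fun y => w y * conj_unless (y \in Y0) (f (phi y))) \in is_C0.
  apply/is_C0P; split=> [y|e e0].
    apply: cvgM; first exact: cw.
    apply: (continuous_conj_unless_clopen Y0 (fun z => f (phi z))) => // z.
    by apply: continuous_comp; [exact: cphi|exact: C0_continuous].
  rewrite (_ : [set y | _] = psi @` [set x | e <= normc (f x)]).
    apply: continuous_compact; last exact: C0_vanishes.
    exact: continuous_subspaceT.
  apply/seteqP; split=> [y|_ [x fx <-]] /=.
    rewrite normcM w1 mul1r normc_conj_unless => fy.
    by exists (phi y); rewrite ?phiK.
  by rewrite normcM w1 mul1r normc_conj_unless psiK.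
by exists (fun f => MkC0 (TC0 f)); split.
Qed.

End construction.

Lemma weighted_composition_isomorphism {R : realType} {X Y : topologicalType}
    {T : C0 R X -> C0 R Y} {w phi s} : bijective T ->
  weighted_composition T w phi s ->
  ring_isomorphism_in_norm T /\ forall f, `|T (C0_conj f)| = `|T f|.
Proof.
move=> bT TE; have nT := weighted_composition_normc _ _ _ _ TE.
split; last by move=> f; apply: C0_norm_eq => y; rewrite !nT /= normc_conj.
split=> // f g; last first.
  by apply: C0_norm_eq => y; rewrite nT /= !normcM !nT.
congr (`|_|); apply: C0_ext => y; rewrite C0_addE; case: TE => _ TE.
rewrite !TE -mulrDr; congr (_ * _); rewrite C0_addE.
by case: (s y) => //=; rewrite rmorphD.
Qed.

Theorem theorem1p1 (R : realType) (X Y : topologicalType)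
    (X_nonempty : [set: X] !=set0) (Y_nonempty : [set: Y] !=set0)
    (X_lc : locally_compact [set: X]) (Y_lc : locally_compact [set: Y])
    (X_hausdorff : hausdorff_space X) (Y_hausdorff : hausdorff_space Y) :
  (forall T : C0 R X -> C0 R Y,
     ring_isomorphism_in_norm T ->
     (forall f : C0 R X, `|T (C0_conj f)| = `|T f|) ->
     exists (w : Y -> R[i]) (phi : Y -> X) (Y0 : set Y),
       [/\ continuous w /\ (forall y, unit_circle R (w y)),
           homeomorphism phi,
           clopen Y0 &
           forall (f : C0 R X) (y : Y),
             T f y = if y \in Y0 then w y * f (phi y)
                     else w y * conjc (f (phi y))])
  /\
  (forall (w : Y -> R[i]) (phi : Y -> X) (Y0 : set Y),
     continuous w -> (forall y, unit_circle R (w y)) ->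
     homeomorphism phi ->
     clopen Y0 ->
     exists T : C0 R X -> C0 R Y,
       [/\ forall (f : C0 R X) (y : Y),
             T f y = if y \in Y0 then w y * f (phi y)
                     else w y * conjc (f (phi y)),
           ring_isomorphism_in_norm T &
           forall f : C0 R X, `|T (C0_conj f)| = `|T f|]).
Proof.
have unit_circleE z : unit_circle R z <-> normc z = 1.
  by split=> [/complexI//|z1]; rewrite /unit_circle /= /Num.norm /= z1.
have branchE (c z : R[i]) b :
    (if b then c * z else c * conjc z) = c * conj_unless b z by case: b.
split=> [T isoT conjT|w phi Y0 cw w1 [cphi [psi [phiK psiK cpsi]]] Y0c].
  have [w [phi [s TE]]] :=
    norm_isomorphism_weighted Y_lc Y_hausdorff isoT conjT.
  have T0 : T 0 = 0.
    apply: (addrI (T 0)).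
    by rewrite -ring_isomorphism_in_norm_additive// !addr0.
  have [[T' TK T'K] _ _] := isoT.
  have normT := weighted_composition_isometry _ _ _ _ TE X_lc X_hausdorff
    (can_inj TK) T0.
  have [isoT' conjT'] := isometric_inverse_isomorphism TK T'K normT isoT.
  have [w' [psi [s' T'E]]] :=
    norm_isomorphism_weighted X_lc X_hausdorff isoT' conjT'.
  exists w, phi, [set y | s y]; split.
  - split.
      exact: weighted_composition_weight_continuous TE X_lc X_hausdorff.
    by move=> y; apply/unit_circleE; case: TE.
  - exact: weighted_composition_homeomorphism TK T'K TE T'E.
  - exact: weighted_composition_side_clopen TE X_lc X_hausdorff.
  - move=> f y; rewrite branchE; case: TE => _ ->; congr (_ * conj_unless _ _).
    by apply/idP/idP => [?|]; rewrite inE.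
have {}w1 y : normc (w y) = 1 by exact/unit_circleE.
have [T TE] :=
  weighted_composition_exists w phi psi Y0 cw w1 cphi cpsi psiK phiK Y0c.
pose X0 := psi @^-1` Y0.
have X0c : clopen X0 by apply: preimage_clopen.
(* on the linear side the inverse has the conjugate weight, on the other side
   the same weight *)
pose w' x := conj_unless (x \in ~` X0) (w (psi x)).
have [T' T'E] : exists T' : C0 R Y -> C0 R X,
    weighted_composition T' w' psi (fun x => x \in X0).
  apply: weighted_composition_exists => //.
  - apply: continuous_conj_unless_clopen; first exact: clopenC.
    by move=> x; apply: continuous_comp; [exact: cpsi|exact: cw].
  - by move=> x; rewrite normc_conj_unless.
have sideE x : (x \in X0) = (psi x \in Y0).
  by apply/idP/idP; rewrite !inE.
have bT : bijective T.
  case: TE T'E => _ TE [_ T'E]; exists T' => f; apply: C0_ext => z.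
    rewrite T'E TE psiK /w' in_setC sideE.
    exact: (proj1 (conj_unlessK _ _ _ (w1 _))).
  rewrite TE T'E phiK /w' in_setC !sideE phiK.
  exact: (proj2 (conj_unlessK _ _ _ (w1 _))).
have [isoT conjT] := weighted_composition_isomorphism bT TE.
by exists T; split=> // f y; rewrite branchE; case: TE.
Qed.
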